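(* Assume that $\lambda_{m-1}<\lambda_m$ if $m>1$, and $\lambda_M<\lambda_{M+1}$. Then $$\|A^{1/2}(\gamma^0-\gamma_h)\|_{\mathfrak S_2(\mathcal H)}^2=\sum_{i=m}^M(\lambda_{ih}-\lambda_i)+2\sum_{i=m}^M\lambda_i\|(1-\gamma_h)\varphi_i^0\|^2$$ and $$\|A^{1/2}(\Phi^0-\Phi_h^0)\|^2=\sum_{i=m}^M(\lambda_{ih}-\lambda_i)+\sum_{i=m}^M\lambda_i\|\varphi_i^0-\varphi_{ih}^0\|^2.$$
   Context: $\mathcal H$ is a real separable Hilbert space with inner product $(\cdot,\cdot)$ and norm $\|\cdot\|$; $\|B\|_{\mathfrak S_2(\mathcal H)}$ is the Hilbert–Schmidt norm. $A$ is a self-adjoint, positive definite operator on $\mathcal H$ with domain $D(A)$ and compact resolvent; $(\lambda_k)_{k\ge1}$ is the nondecreasing sequence of its (positive) eigenvalues counted with multiplicity, $\lambda_k\to+\infty$, and $(\varphi_k^0)_{k\ge1}$ is an orthonormal basis of $\mathcal H$ with $A\varphi_k^0=\lambda_k\varphi_k^0$. For $s\in\mathbb{R}$, $D(A^s):=\{v\in\mathcal H:\sum_k\lambda_k^{2s}|(v,\varphi_k^0)|^2<\infty\}$ and $A^sv:=\sum_k\lambda_k^s(v,\varphi_k^0)\varphi_k^0$. Let $1\le m\le M$ be integers, $J:=M-m+1$. $V_h\subset D(A^{1/2})$ is a finite-dimensional subspace with $\dim V_h\ge M$. The approximate eigenpairs $(\varphi_{kh},\lambda_{kh})\in V_h\times\mathbb{R}_+$,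 $1\le k\le\dim V_h$, satisfy $(\varphi_{kh},\varphi_{jh})=\delta_{kj}$, $(A^{1/2}\varphi_{kh},A^{1/2}v_h)=\lambda_{kh}(\varphi_{kh},v_h)$ for all $v_h\in V_h$, and $0<\lambda_{1h}\le\lambda_{2h}\le\cdots$ (counting multiplicities). The density matrices are $\gamma^0v:=\sum_{i=m}^M(v,\varphi_i^0)\varphi_i^0$ and $\gamma_hv:=\sum_{i=m}^M(v,\varphi_{ih})\varphi_{ih}$ for $v\in\mathcal H$. For a $J$-tuple $\Psi=(\psi_m,\dots,\psi_M)$ in $[D(A^s)]^J$, $\|A^s\Psi\|:=(\sum_{i=m}^M\|A^s\psi_i\|^2)^{1/2}$. $\Phi^0:=(\varphi_m^0,\dots,\varphi_M^0)$, $\Phi_h:=(\varphi_{mh},\dots,\varphi_{Mh})$, and $\Phi_h^0=(\varphi_{mh}^0,\dots,\varphi_{Mh}^0):=U\Phi_h$, where $U$ minimizes $\|U\Phi_h-\Phi^0\|$ over the group $O(J)$ of real orthogonal $J\times J$ matrices (acting by linear combinations of the entries of the tuple). *)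

(* Defs.v *)
From HB Require Import structures.
From mathcomp Require Import all_boot all_order all_algebra.
From mathcomp Require Import sesquilinear.
From mathcomp Require Import all_classical all_reals all_analysis.
Import Order.TTheory GRing.Theory Num.Theory.
Import numFieldNormedType.Exports.

Set Implicit Arguments.
Unset Strict Implicit.
Unset Printing Implicit Defensive.

Local Open Scope classical_set_scope.
Local Open Scope ring_scope.

(* Infinite sequences (eigenvalues, eigenvectors, orthonormal bases) are
   functions on nat read at the indices k >= 1; the value at 0 is never
   constrained nor used. *)

(* A real Hilbert space is a complete normed module H over R together with an
   inner product [ip : {dot H for @idfun R}] such that [norm_from_dot ip]. *)
Definition norm_from_dot (R : realType) (H : completeNormedModType R)
    (ip : {dot H for @idfun R}) : Prop :=
  forall v, `|v| = Num.sqrt (ip v v).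

Definition separable (T : topologicalType) : Prop :=
  exists2 S : set T, countable S & dense S.

(* Possibly unbounded linear operator; [op_fun] is only meaningful on
   [op_dom]. *)
Record operator (R : realType) (H : completeNormedModType R) := Operator {
  op_dom : set H;
  op_fun :> H -> H;
  op_dom0 : op_dom 0;
  op_domP : forall (a : R) u v, op_dom u -> op_dom v -> op_dom (a *: u + v);
  op_linear : forall (a : R) u v, op_dom u -> op_dom v ->
    op_fun (a *: u + v) = a *: op_fun u + op_fun v }.

Section Hilbert.
Variables (R : realType) (H : completeNormedModType R).
Variable ip : {dot H for @idfun R}.

(* The second clause says that A and its adjoint have the same graph: u lies
   in the domain of the adjoint with value w iff (A v, u) = (v, w) for all v
   in D(A). *)
Definition self_adjoint (A : operator H) : Prop :=
  dense (op_dom A) /\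
  forall u w, (op_dom A u /\ A u = w) <->
              (forall v, op_dom A v -> ip (A v) u = ip v w).

Definition positive_definite (A : operator H) : Prop :=
  forall v, op_dom A v -> v != 0 -> 0 < ip (A v) v.

Definition compact_operator (T : H -> H) : Prop :=
  forall B : set H, bounded_set B -> compact (closure (T @` B)).

(* T is the inverse of A - z on its domain. *)
Definition is_resolvent (A : operator H) (z : R) (T : H -> H) : Prop :=
  (forall u, op_dom A (T u) /\ A (T u) - z *: T u = u) /\
  (forall v, op_dom A v -> T (A v - z *: v) = v).

Definition has_compact_resolvent (A : operator H) : Prop :=
  exists z T, is_resolvent A z T /\ compact_operator T.

Definition orthonormal_basis (e : nat -> H) : Prop :=
  (forall k j, (1 <= k)%N -> (1 <= j)%N -> ip (e k) (e j) = (k == j)%:R) /\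
  (forall v, \sum_(1 <= k < n) ip v (e k) *: e k @[n --> \oo] --> v).

(* Since (phi k) is a basis, lam lists each eigenvalue of A according to its
   multiplicity. *)
Definition spectral_data (A : operator H) (lam : nat -> R) (phi : nat -> H)
    : Prop :=
  [/\ orthonormal_basis phi,
      (forall k, (1 <= k)%N -> op_dom A (phi k) /\ A (phi k) = lam k *: phi k),
      (forall k, (1 <= k)%N -> 0 < lam k),
      (forall k j, (1 <= k)%N -> (k <= j)%N -> lam k <= lam j)
    & lam k @[k --> \oo] --> +oo].

(* D(A^s) and A^s; the series defining A^s v is only meaningful for v in
   D(A^s). *)
Definition dom_pow (lam : nat -> R) (phi : nat -> H) (s : R) : set H :=
  [set v | (\sum_(1 <= k <oo) (lam k `^ (2 * s) * `|ip v (phi k)| ^+ 2)%:E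
            < +oo)%E].

Definition op_pow (lam : nat -> R) (phi : nat -> H) (s : R) (v : H) : H :=
  limn (fun n => \sum_(1 <= k < n) (lam k `^ s * ip v (phi k)) *: phi k).

Definition has_dim (V : set H) (n : nat) : Prop :=
  exists b : 'I_n -> H,
    (forall c : 'I_n -> R, \sum_i c i *: b i = 0 -> forall i, c i = 0) /\
    V = [set v | exists c : 'I_n -> R, v = \sum_i c i *: b i].

(* lamh and phih are read at the indices 1, ..., N = dim V. *)
Definition approx_eigenpairs (lam : nat -> R) (phi : nat -> H)
    (V : set H) (N : nat) (lamh : nat -> R) (phih : nat -> H) : Prop :=
  [/\ (forall k, (1 <= k <= N)%N -> V (phih k)),
      (forall k j, (1 <= k <= N)%N -> (1 <= j <= N)%N ->
         ip (phih k) (phih j) = (k == j)%:R),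
      (forall k v, (1 <= k <= N)%N -> V v ->
         ip (op_pow lam phi (1 / 2) (phih k)) (op_pow lam phi (1 / 2) v) =
         lamh k * ip (phih k) v),
      (forall k, (1 <= k <= N)%N -> 0 < lamh k)
    & (forall k j, (1 <= k)%N -> (k <= j <= N)%N -> lamh k <= lamh j)].

Definition density (m M : nat) (f : nat -> H) (v : H) : H :=
  \sum_(m <= i < M.+1) ip v (f i) *: f i.

(* Hilbert-Schmidt norm computed in the orthonormal basis e; it is valued in
   the extended reals and, for B bounded and linear, does not depend on e. *)
Definition hs_norm (e : nat -> H) (B : H -> H) : \bar R :=
  sqrte (\sum_(1 <= k <oo) (`|B (e k)| ^+ 2)%:E)%E.

End Hilbert.

(* J-tuples of vectors are functions on 'I_J; for J = M - m + 1, position i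
   holds the entry of index m + i. *)
Section Tuples.
Variables (R : realType) (H : completeNormedModType R).

Definition slice (m M : nat) (f : nat -> H) : 'I_(M - m).+1 -> H :=
  fun i => f (m + i)%N.

Definition tuple_norm (J : nat) (Psi : 'I_J -> H) : R :=
  Num.sqrt (\sum_i `|Psi i| ^+ 2).

Definition tuple_act (J : nat) (U : 'M[R]_J) (Psi : 'I_J -> H) : 'I_J -> H :=
  fun i => \sum_j U i j *: Psi j.

Definition orthogonal_group (J : nat) : set 'M[R]_J :=
  [set U | U *m U^T = 1%:M].

Definition best_rotation (J : nat) (Psi Psi' : 'I_J -> H) (U : 'M[R]_J)
    : Prop :=
  orthogonal_group U /\
  forall W, orthogonal_group W ->
    tuple_norm (tuple_act U Psi \- Psi') <= tuple_norm (tuple_act W Psi \- Psi').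

End Tuples.

Arguments slice {R H} m M f i.

(* Main.v *)
(* The operator A^(1/2) (gamma^0 - gamma_h) has finite rank, so Parseval's
   identity turns its squared Hilbert-Schmidt norm in any orthonormal basis
   into a finite double sum of products of inner products. Everything then
   follows from
     (A^(1/2) phi_i, A^(1/2) v) = lambda_i (phi_i, v)   for v in D(A^(1/2)),
     (A^(1/2) phi_ih, A^(1/2) phi_jh) = lambda_ih delta_ij.
   The second identity is the same expansion; summing over the tuple, the
   orthogonality of U gives sum_i |A^(1/2) phi_ih^0|^2 = sum_i lambda_ih. *)

Require Import Defs.
From HB Require Import structures.
From mathcomp Require Import all_boot all_order all_algebra.
From mathcomp Require Import sesquilinear.
From mathcomp Require Import all_classical all_reals all_analysis.
From mathcomp Require Import ring lra.
Import Order.TTheory GRing.Theory Num.Theory.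
Import numFieldNormedType.Exports.

Set Implicit Arguments.
Unset Strict Implicit.
Unset Printing Implicit Defensive.

Local Open Scope classical_set_scope.
Local Open Scope ring_scope.

(** * Sums from index 1 and Kronecker deltas *)

Lemma series_from1 (V : zmodType) (u : nat -> V) :
  (fun n => \sum_(1 <= k < n) u k) =
  series (fun k => if k is 0 then 0 else u k).
Proof.
apply/funext => -[|n]; rewrite /series /=; first by rewrite !big_geq.
rewrite [RHS]big_ltn // add0r.
by apply: eq_big_nat => -[|k].
Qed.

Lemma sum_diag (V : nmodType) (I : eqType) (r : seq I) (F : I -> I -> V) :
  uniq r -> \sum_(i <- r) \sum_(j <- r) F i j *+ (i == j) = \sum_(i <- r) F i i.
Proof.
move=> r_uniq; apply: eq_big_seq => i ri.
rewrite (bigD1_seq i) //= eqxx big1 ?addr0 // => j ji.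
by rewrite eq_sym (negPf ji).
Qed.

Lemma sum_diag1 (V : nmodType) (k n : nat) (F : nat -> V) : (1 <= k < n)%N ->
  \sum_(1 <= j < n) F j *+ (k == j) = F k.
Proof.
move=> kn; rewrite (bigD1_seq k) ?mem_index_iota ?iota_uniq //= eqxx.
by rewrite big1 ?addr0 // => j jk; rewrite eq_sym (negPf jk).
Qed.

(** * Inner product: Cauchy-Schwarz, Parseval, Pythagoras and Riesz-Fischer *)

Section HilbertSpace.
Variables (R : realType) (H : completeNormedModType R).
Variable ip : {dot H for @idfun R}.
Hypothesis ip_norm : norm_from_dot ip.

Lemma ip_sym u v : ip u v = ip v u.
Proof. by rewrite hermC expr0 mul1r. Qed.

Lemma ip0l v : ip 0 v = 0.
Proof. exact: linear0l. Qed.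

Lemma ipDl u v w : ip (u + v) w = ip u w + ip v w.
Proof. exact: linearDl. Qed.

Lemma ipNl u v : ip (- u) v = - ip u v.
Proof. exact: linearNl. Qed.

Lemma ipBl u v w : ip (u - v) w = ip u w - ip v w.
Proof. exact: linearBl. Qed.

Lemma ipZl a u v : ip (a *: u) v = a * ip u v.
Proof. exact: linearZl_LR. Qed.

Lemma ipZr a u v : ip u (a *: v) = a * ip u v.
Proof. by rewrite ip_sym ipZl ip_sym. Qed.

Lemma ip_sumr (I : Type) (r : seq I) (P : pred I) (f : I -> H) v :
  ip v (\sum_(i <- r | P i) f i) = \sum_(i <- r | P i) ip v (f i).
Proof. exact: linear_sumr. Qed.

Lemma ip_suml (I : Type) (r : seq I) (P : pred I) (f : I -> H) v :
  ip (\sum_(i <- r | P i) f i) v = \sum_(i <- r | P i) ip (f i) v.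
Proof. exact: linear_sumlz. Qed.

Lemma ip_ge0 v : 0 <= ip v v.
Proof.
have [->|v0] := eqVneq v 0; first by rewrite ip0l.
exact/ltW/neq0_dnorm_gt0.
Qed.

Lemma normH_sqr v : `|v| ^+ 2 = ip v v.
Proof. by rewrite ip_norm sqr_sqrtr // ip_ge0. Qed.

Lemma normH_sqrB u v : `|u - v| ^+ 2 = `|u| ^+ 2 + `|v| ^+ 2 - 2 * ip u v.
Proof.
rewrite !normH_sqr ipBl !(ip_sym _ (u - v)) !ipBl (ip_sym v u); ring.
Qed.

(** Squaring the triangle inequality, which the norm of [H] satisfies, bounds [ip x y] from one
    side; replacing [u] by [- u] then bounds the absolute value. *)
Lemma CauchySchwarz u v : `|ip u v| <= `|u| * `|v|.
Proof.
have half x y : ip x y <= `|x| * `|y|.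
  have : `|x - (- y)| ^+ 2 <= (`|x| + `|y|) ^+ 2.
    by rewrite ler_sqr ?nnegrE ?addr_ge0 // opprK ler_normD.
  rewrite normH_sqrB normrN (ip_sym x) ipNl (ip_sym y) sqrrD; lra.
by rewrite ler_norml half andbT lerNl -ipNl (le_trans (half _ _)) ?normrN.
Qed.

Lemma cvg_ipl (u_ : nat -> H) (u w : H) :
  u_ n @[n --> \oo] --> u -> ip (u_ n) w @[n --> \oo] --> ip u w.
Proof.
move=> u_u; apply/cvgrPdist_lt => e e0.
(* The [+ 1] keeps the divisor positive when [w] is zero. *)
have d0 : 0 < e / (`|w| + 1) by rewrite divr_gt0 // ltr_wpDl.
move/cvgrPdist_lt : u_u => /(_ _ d0); apply: filterS => n.
rewrite ltr_pdivlMr ?ltr_wpDl // => lt_e; rewrite -ipBl.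
apply: le_lt_trans (CauchySchwarz _ _) _; apply: le_lt_trans lt_e.
by rewrite ler_wpM2l // lerDl.
Qed.

Lemma Parseval (e : nat -> H) (u v : H) : orthonormal_basis ip e ->
  \sum_(1 <= k < n) ip u (e k) * ip v (e k) @[n --> \oo] --> ip u v.
Proof.
move=> [_ /(_ u) /(@cvg_ipl _ _ v)]; apply: cvg_trans.
rewrite (_ : (fun n => _) = (fun n => ip (\sum_(1 <= k < n) ip u (e k) *: e k) v)) //.
apply/funext => n; rewrite ip_suml; apply: eq_bigr => k _.
by rewrite ipZl (ip_sym v).
Qed.

(** Pythagoras with weights: [d i] is the squared norm of [w i], equal to 1 for orthonormal families
    and to an approximate eigenvalue for the images of the [phih] under the square root. *)
Lemma normH_sqr_sum (I : eqType) (r : seq I) (a d : I -> R) (w : I -> H) :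
  uniq r -> {in r &, forall i j, ip (w i) (w j) = d i *+ (i == j)} ->
  `|\sum_(i <- r) a i *: w i| ^+ 2 = \sum_(i <- r) a i ^+ 2 * d i.
Proof.
move=> r_uniq w_orth.
rewrite normH_sqr ip_suml -(sum_diag (fun i j => a i * a j * d i)) //.
apply: eq_big_seq => i ri; rewrite ip_sumr; apply: eq_big_seq => j rj.
by rewrite ipZl ipZr w_orth // mulrA mulrnAr.
Qed.

(** Pythagoras turns squared norms of blocks of the vector series into blocks of the scalar one, so
    the Cauchy property passes over and completeness of [H] gives the limit. *)
Lemma Riesz_Fischer (phi : nat -> H) (a : nat -> R) :
  (forall k j, (1 <= k)%N -> (1 <= j)%N -> ip (phi k) (phi j) = (k == j)%:R) ->
  cvgn (fun n => \sum_(1 <= k < n) a k ^+ 2) ->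
  cvgn (fun n => \sum_(1 <= k < n) a k *: phi k).
Proof.
move=> on; rewrite !series_from1.
set u := (X in series X); set w := (X in _ -> cvgn (series X)).
have uw p q : `|\sum_(p <= k < q) w k| ^+ 2 = \sum_(p <= k < q) u k.
  have key r : (1 <= r)%N ->
      `|\sum_(r <= k < q) w k| ^+ 2 = \sum_(r <= k < q) u k.
    move=> r1; rewrite (eq_big_nat _ _ (F2 := fun k => a k *: phi k)).
      rewrite (@normH_sqr_sum _ _ a (fun=> 1) phi) ?iota_uniq //.
        apply: eq_big_nat => k /andP[/(leq_trans r1)].
        by rewrite mulr1; case: k.
      move=> k j; rewrite !mem_index_iota => /andP[rk _] /andP[rj _].
      by rewrite on // (leq_trans r1).
    by move=> [|k] // /andP[/(leq_trans r1)].
  (* Orthonormality says nothing about [phi 0], but both series have term zero at index 0, so a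
     block from 0 reduces to one from 1. *)
  case: p => [|p]; last exact: key.
  case: q key => [|q] key; first by rewrite !big_geq // normr0 expr0n.
  by rewrite big_ltn // [RHS]big_ltn //= !add0r key.
move=> /cauchy_cvgP/cauchy_seriesP cu; apply/cauchy_cvgP/cauchy_seriesP => e e0.
apply: filterS (cu (e ^+ 2) (exprn_gt0 _ e0)) => -[p q] /=.
rewrite -uw normrX normr_id ltr_sqr ?nnegrE //; exact: ltW.
Qed.

(** * Powers of the operator in its eigenbasis *)

Section Powers.
Variables (lam : nat -> R) (phi : nat -> H) (s : R).
Hypothesis phi_on :
  forall k j, (1 <= k)%N -> (1 <= j)%N -> ip (phi k) (phi j) = (k == j)%:R.

(** With convergence of the defining series in place of [dom_pow], linearity of the power is a plain
    limit law. *)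
Definition summable_pow : set H := [set v |
  cvgn (fun n => \sum_(1 <= k < n) (lam k `^ s * ip v (phi k)) *: phi k)].

(** The squared coefficients of the series are the terms of the sum in [dom_pow], so Riesz-Fischer
    applies. *)
Lemma summable_pow_dom : dom_pow ip lam phi s `<=` summable_pow.
Proof.
move=> v; rewrite /dom_pow/= => vdom; apply: Riesz_Fischer => //.
set b := fun k => (lam k `^ s * ip v (phi k)) ^+ 2.
have bE k : lam k `^ (2 * s) * `|ip v (phi k)| ^+ 2 = b k.
  rewrite /b exprMn real_normK ?num_real //; congr (_ * _).
  by rewrite mulrC powRrM -powR_mulrn // powR_ge0.
have b0 k : 0 <= b k by exact: sqr_ge0.
move: vdom; under eq_eseriesr do rewrite bE.
set L := (X in (X < _)%E) => L_fin.
have L0 : (0 <= L)%E by apply: nneseries_ge0 => k _ _; rewrite lee_fin.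
apply: nondecreasing_is_cvgn.
  apply/nondecreasing_seqP => -[|n]; first by rewrite !big_geq.
  by rewrite [leRHS]big_nat_recr //= lerDl sqr_ge0.
exists (fine L) => _ [n _ <-]; rewrite -lee_fin fineK; last first.
  by rewrite ge0_fin_numE.
rewrite -sumEFin; by apply: nneseries_lim_ge => k _; rewrite lee_fin sqr_ge0.
Qed.

Lemma op_pow_cvg v : summable_pow v ->
  \sum_(1 <= k < n) (lam k `^ s * ip v (phi k)) *: phi k @[n --> \oo]
    --> op_pow ip lam phi s v.
Proof. by []. Qed.

Lemma op_pow_lim v l :
  \sum_(1 <= k < n) (lam k `^ s * ip v (phi k)) *: phi k @[n --> \oo] --> l ->
  summable_pow v /\ op_pow ip lam phi s v = l.
Proof. by move=> v_l; split; [exact: (cvgP l v_l) | apply: cvg_lim]. Qed.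

Lemma op_pow_eigen k : (1 <= k)%N ->
  summable_pow (phi k) /\ op_pow ip lam phi s (phi k) = lam k `^ s *: phi k.
Proof.
move=> k1.
apply: op_pow_lim; apply: cvg_near_cst; exists k.+1 => // n /= kn.
rewrite -[RHS](@sum_diag1 _ k n (fun j => lam j `^ s *: phi j)) ?k1 //.
apply: eq_big_nat => j /andP[j1 _].
by rewrite phi_on // mulr_natr scalerMnl.
Qed.

Lemma op_pow_lin a u v : summable_pow u -> summable_pow v ->
  summable_pow (a *: u + v) /\
  op_pow ip lam phi s (a *: u + v) =
    a *: op_pow ip lam phi s u + op_pow ip lam phi s v.
Proof.
move=> /op_pow_cvg cu /op_pow_cvg cv.
apply: op_pow_lim; under eq_cvg => n.
  under eq_bigr do rewrite ipDl ipZl mulrDr scalerDl mulrCA -(scalerA a).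
  rewrite big_split /= -scaler_sumr; over.
exact: cvgD (cvgZl_tmp (k := a) cu) cv.
Qed.

Lemma op_pow_sum (I : eqType) (r : seq I) (a : I -> R) (f : I -> H) :
  {in r, forall i, summable_pow (f i)} ->
  summable_pow (\sum_(i <- r) a i *: f i) /\
  op_pow ip lam phi s (\sum_(i <- r) a i *: f i) =
    \sum_(i <- r) a i *: op_pow ip lam phi s (f i).
Proof.
elim: r => [_|i r IHr fr].
  rewrite !big_nil; apply: op_pow_lim; apply: cvg_near_cst; apply: nearW => n.
  by rewrite big1 // => k _; rewrite ip0l mulr0 scale0r.
have [|sum_r op_r] := IHr; first by move=> j rj; apply: fr; rewrite inE rj orbT.
rewrite !big_cons -op_r; apply: op_pow_lin => //; apply: fr.
by rewrite inE eqxx.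
Qed.

(** Pairing with [phi k] is continuous and gives the same value on all partial sums that contain
    index [k]. *)
Lemma ip_op_pow_eigen k v : (1 <= k)%N -> summable_pow v ->
  ip (op_pow ip lam phi s v) (phi k) = lam k `^ s * ip v (phi k).
Proof.
move=> k1 /op_pow_cvg /(@cvg_ipl _ _ (phi k)) /cvg_lim <- //.
apply: cvg_lim => //; apply: cvg_near_cst; exists k.+1 => // n /= kn.
rewrite ip_suml -[RHS](@sum_diag1 _ k n (fun j => lam j `^ s * ip v (phi j))) ?k1 //.
apply: eq_big_nat => j /andP[j1 _].
by rewrite ipZl phi_on // eq_sym mulr_natr.
Qed.

End Powers.

(** * Hilbert-Schmidt norms of finite-rank operators *)

Lemma Parseval_finite_rank (e : nat -> H) (I : Type) (r : seq I)
    (f a g b : I -> H) : orthonormal_basis ip e ->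
  \sum_(1 <= k < n) ip (\sum_(i <- r) ip (e k) (f i) *: a i)
                       (\sum_(j <- r) ip (e k) (g j) *: b j) @[n --> \oo]
    --> \sum_(i <- r) \sum_(j <- r) ip (f i) (g j) * ip (a i) (b j).
Proof.
move=> e_basis.
(* The finite sums over [i] and [j] move outside the sum over [k], leaving inside the Parseval sum
   of [f i] and [g j]. *)
rewrite (_ : (fun n => _) = fun n => \sum_(i <- r) \sum_(j <- r)
    (\sum_(1 <= k < n) ip (f i) (e k) * ip (g j) (e k)) * ip (a i) (b j)).
  apply: cvg_big => [|i _]; first exact: add_continuous.
  apply: cvg_big => [|j _]; first exact: add_continuous.
  apply: cvgMr_tmp.
  exact: Parseval.
apply/funext => n.
under eq_bigr do (rewrite ip_suml; under eq_bigr do rewrite ip_sumr).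
rewrite exchange_big; apply: eq_bigr => i _.
rewrite exchange_big; apply: eq_bigr => j _.
rewrite mulr_suml; apply: eq_bigr => k _.
by rewrite ipZl ipZr (ip_sym (f i)) (ip_sym (g j)) mulrA.
Qed.

(** The squared norm of [B (e k)] splits into two squares and a cross term, and each has a Parseval
    limit free of [e]. *)
Lemma sqr_hs_normB_finite_rank (e : nat -> H) (I : Type) (r : seq I)
    (f a g b : I -> H) (B : H -> H) :
  (forall v, B v = \sum_(i <- r) ip v (f i) *: a i
                   - \sum_(i <- r) ip v (g i) *: b i) ->
  orthonormal_basis ip e ->
  (hs_norm e B ^+ 2)%E =
  (\sum_(i <- r) \sum_(j <- r) ip (f i) (f j) * ip (a i) (a j)
   + \sum_(i <- r) \sum_(j <- r) ip (g i) (g j) * ip (b i) (b j)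
   - 2 * \sum_(i <- r) \sum_(j <- r) ip (f i) (g j) * ip (a i) (b j))%:E.
Proof.
move=> BE e_basis; rewrite /hs_norm sqr_sqrte; last first.
  by apply: nneseries_ge0 => k _ _; rewrite lee_fin exprn_ge0.
apply/cvg_lim => //; rewrite (_ : (fun n => _) =
    EFin \o (fun n => \sum_(1 <= k < n) `|B (e k)| ^+ 2)); last first.
  by apply/funext => n /=; rewrite sumEFin.
apply: cvg_EFin; first exact: nearW.
have cff := @Parseval_finite_rank e I r f a f a e_basis.
have cgg := @Parseval_finite_rank e I r g b g b e_basis.
have cfg := @Parseval_finite_rank e I r f a g b e_basis.
under eq_cvg => n.
  rewrite /=; under eq_bigr do rewrite BE normH_sqrB !normH_sqr.
  rewrite sumrB big_split /= -mulr_sumr; over.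
exact: cvgB (cvgD cff cgg) (cvgMl_tmp (a := 2) cfg).
Qed.

End HilbertSpace.

(** * Energy-norm identities for density matrices and rotated tuples *)

Lemma sqr_powR_half (R : realType) (x : R) : 0 < x -> (x `^ (1 / 2)) ^+ 2 = x.
Proof.
move=> x0; rewrite -powR_mulrn ?powR_ge0 // -powRrM div1r mulVf ?pnatr_eq0 //.
by rewrite powRr1 // ltW.
Qed.

Lemma big_nat_slice (V : nmodType) (m M : nat) (F : nat -> V) : (m <= M)%N ->
  \sum_(m <= i < M.+1) F i = \sum_(i < (M - m).+1) F (m + i)%N.
Proof.
move=> mM; rewrite -{1}[m]add0n big_addn subSn // big_mkord.
by apply: eq_bigr => i _; rewrite addnC.
Qed.

Theorem lemma3p1 (R : realType) (H : completeNormedModType R)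
    (ip : {dot H for @idfun R})
    (ip_norm : norm_from_dot ip) (H_separable : separable H)
    (A : operator H) (A_sa : self_adjoint ip A)
    (A_pos : positive_definite ip A) (A_res : has_compact_resolvent A)
    (lam : nat -> R) (phi : nat -> H) (A_spec : spectral_data ip A lam phi)
    (m M : nat) (m_ge1 : (1 <= m)%N) (m_le_M : (m <= M)%N)
    (V : set H) (N : nat) (V_dim : has_dim V N) (M_le_N : (M <= N)%N)
    (V_dom : V `<=` dom_pow ip lam phi (1 / 2))
    (lamh : nat -> R) (phih : nat -> H)
    (pairs_h : approx_eigenpairs ip lam phi V N lamh phih)
    (gap_m : (1 < m)%N -> lam m.-1 < lam m) (gap_M : lam M < lam M.+1) :
  let Ahalf := op_pow ip lam phi (1 / 2) in
  let gamma0 := density ip m M phi in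
  let gammah := density ip m M phih in
  let B := fun v : H => Ahalf (gamma0 v - gammah v) in
  let Phi0 := slice m M phi in
  let Phih := slice m M phih in
  (forall e : nat -> H, orthonormal_basis ip e ->
     (hs_norm e B ^+ 2)%E =
     (\sum_(m <= i < M.+1) (lamh i - lam i)
      + 2 * \sum_(m <= i < M.+1) lam i * `|phi i - gammah (phi i)| ^+ 2)%:E)
  /\
  (forall U : 'M[R]_((M - m).+1), best_rotation Phih Phi0 U ->
     let Phih0 := tuple_act U Phih in
     tuple_norm (fun i => Ahalf (Phi0 i - Phih0 i)) ^+ 2 =
     \sum_(m <= i < M.+1) (lamh i - lam i)
     + \sum_(i < (M - m).+1) lam (m + i)%N * `|Phi0 i - Phih0 i| ^+ 2).
Proof.
move=> Ahalf gamma0 gammah B Phi0 Phih.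
case: A_spec => [[phi_on _] _ lam_gt0 _ _].
case: pairs_h => [phih_V phih_on phih_lam _ _].
pose S := summable_pow ip lam phi (1 / 2).
have S_phih k : (1 <= k <= N)%N -> S (phih k).
  by move=> kN; apply/(summable_pow_dom ip_norm phi_on)/V_dom/phih_V.
have S_phi k : (1 <= k)%N -> S (phi k) /\ Ahalf (phi k) = lam k `^ (1 / 2) *: phi k.
  exact: op_pow_eigen.
(* One factor of the square root of [lam i] is the explicit scalar, the other is the coefficient of
   [Ahalf v] along [phi i]. *)
have ip_cross i v : (1 <= i)%N -> S v ->
    ip (lam i `^ (1 / 2) *: phi i) (Ahalf v) = lam i * ip (phi i) v.
  move=> i1 Sv; rewrite ipZl ip_sym ip_op_pow_eigen // mulrA -expr2.
  by rewrite sqr_powR_half ?lam_gt0 // ip_sym.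
have ip_Aphih i j : (1 <= i <= N)%N -> (1 <= j <= N)%N ->
    ip (Ahalf (phih i)) (Ahalf (phih j)) = lamh i *+ (i == j).
  by move=> iN jN; rewrite phih_lam ?phih_on ?mulr_natr //; exact: phih_V.
have ge1 i : (m <= i < M.+1)%N -> (1 <= i)%N.
  by move=> /andP[/(leq_trans m_ge1)].
have le_N i : (m <= i < M.+1)%N -> (1 <= i <= N)%N.
  by move=> miM; rewrite ge1 //; case/andP: miM => _; rewrite ltnS => /leq_trans; exact.
split=> [e e_basis|U [U_orth _] Phih0].
- set r := index_iota m M.+1.
  have r_uniq : uniq r by exact: iota_uniq.
  (* Both parts of [B] have finite rank: [Ahalf] is moved onto the range vectors [phi i] and
     [phih i]. *)
  rewrite (@sqr_hs_normB_finite_rank _ _ _ ip_norm e _ r phi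
    (fun i => lam i `^ (1 / 2) *: phi i) phih (fun i => Ahalf (phih i)) B) //;
    last first.
    move=> v; rewrite /B /gamma0 /gammah /density -/r.
    have S0 i : i \in r -> S (phi i).
      by rewrite mem_index_iota => /ge1 /S_phi[].
    have Sh i : i \in r -> S (phih i).
      by rewrite mem_index_iota => /le_N /S_phih.
    have [S0s A0] := op_pow_sum (fun i => ip v (phi i)) S0.
    have [Shs Ah] := op_pow_sum (fun i => ip v (phih i)) Sh.
    rewrite addrC -scaleN1r /Ahalf.
    rewrite (op_pow_lin (-1) Shs S0s).2 A0 Ah scaleN1r addrC.
    congr (_ - _); apply: eq_big_nat => i.
    by move=> /ge1 /S_phi[_ <-].
  congr EFin.
  have -> : \sum_(i <- r) \sum_(j <- r) ip (phi i) (phi j) *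
      ip (lam i `^ (1 / 2) *: phi i) (lam j `^ (1 / 2) *: phi j) =
      \sum_(i <- r) lam i.
    rewrite -(sum_diag (fun i j => lam i)) //.
    apply: eq_big_nat => i /ge1 i1; apply: eq_big_nat => j /ge1 j1.
    rewrite ipZl ipZr phi_on // mulr_natl mulr_natr; case: eqP => [->|//].
    by rewrite !mulr1n -expr2 sqr_powR_half ?lam_gt0.
  have -> : \sum_(i <- r) \sum_(j <- r) ip (phih i) (phih j) *
      ip (Ahalf (phih i)) (Ahalf (phih j)) = \sum_(i <- r) lamh i.
    rewrite -(sum_diag (fun i j => lamh i)) //.
    apply: eq_big_nat => i /le_N iN; apply: eq_big_nat => j /le_N jN.
    by rewrite phih_on // ip_Aphih // mulr_natl; case: eqP.
  (* The inner sum obtained here is the squared norm of [gammah (phi i)]. *)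
  have -> : \sum_(i <- r) \sum_(j <- r) ip (phi i) (phih j) *
      ip (lam i `^ (1 / 2) *: phi i) (Ahalf (phih j)) =
      \sum_(i <- r) lam i * \sum_(j <- r) ip (phi i) (phih j) ^+ 2.
    apply: eq_big_nat => i /ge1 i1; rewrite mulr_sumr.
    apply: eq_big_nat => j /le_N jN; rewrite ip_cross //; last exact: S_phih.
    ring.
  rewrite -/r.
  (* For the projection [gammah], the squared distance from the unit vector [phi i] is 1 minus the
     squared norm of its image. *)
  have -> : \sum_(i <- r) lam i * `|phi i - gammah (phi i)| ^+ 2 =
      \sum_(i <- r) (lam i - lam i * \sum_(j <- r) ip (phi i) (phih j) ^+ 2).
    apply: eq_big_nat => i /ge1 i1.
    rewrite (normH_sqrB ip_norm) (normH_sqr ip_norm) phi_on // eqxx mulr1n.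
    rewrite /gammah /density -/r (@normH_sqr_sum _ _ _ ip_norm _ r _ (fun=> 1)) //.
      rewrite ip_sumr; under eq_bigr do rewrite mulr1.
      under [X in 2 * X]eq_bigr do rewrite ipZr -expr2.
      ring.
    by move=> j k; rewrite !mem_index_iota => /le_N jN /le_N kN; exact: phih_on.
  rewrite !sumrB; ring.
- have mi (i : 'I_(M - m).+1) : (m <= m + i < M.+1)%N.
    by rewrite leq_addr -ltn_subRL subSn // ltn_ord.
  have mi_eq (i j : 'I_(M - m).+1) : ((m + i)%N == (m + j)%N) = (i == j).
    by rewrite eqn_add2l.
  rewrite /tuple_norm sqr_sqrtr; last by apply: sumr_ge0 => i _; rewrite sqr_ge0.
  rewrite !big_nat_slice //.
  have Uvec (w : 'I_(M - m).+1 -> H) (d : 'I_(M - m).+1 -> R) i :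
      (forall j k, ip (w j) (w k) = d j *+ (j == k)) ->
      `|\sum_j U i j *: w j| ^+ 2 = \sum_j U i j ^+ 2 * d j.
    move=> w_orth; apply: (normH_sqr_sum ip_norm) => //.
    exact: index_enum_uniq.
  (* Unit rows of [U] normalize each rotated vector; unit columns, from the transposed product, make
     the approximate eigenvalues sum up correctly at the end. *)
  have Urow i : \sum_j U i j ^+ 2 = 1.
    move/matrixP : U_orth => /(_ i i); rewrite !mxE eqxx mulr1n => <-.
    by apply: eq_bigr => j _; rewrite mxE expr2.
  have Ucol j : \sum_i U i j ^+ 2 = 1.
    move/matrixP : (mulmx1C U_orth) => /(_ j j); rewrite !mxE eqxx mulr1n => <-.
    by apply: eq_bigr => i _; rewrite mxE expr2.
  have Phih0_norm i : `|Phih0 i| ^+ 2 = 1.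
    rewrite (Uvec _ (fun=> 1)); first by under eq_bigr do rewrite mulr1.
    by move=> j k; rewrite phih_on ?le_N // mi_eq.
  have Phih0_pow i : S (Phih0 i) /\
      Ahalf (Phih0 i) = \sum_j U i j *: Ahalf (Phih j).
    by apply: op_pow_sum => j _; apply/S_phih/le_N.
  (* Both squared norms contain the same product of [Phi0 i] and [Phih0 i]. As these are unit
     vectors, eliminating it leaves minus [lam (m + i)]. *)
  have lhsE i : `|Ahalf (Phi0 i - Phih0 i)| ^+ 2 =
      \sum_j U i j ^+ 2 * lamh (m + j)%N - lam (m + i)%N
      + lam (m + i)%N * `|Phi0 i - Phih0 i| ^+ 2.
    have mi1 := ge1 _ (mi i).
    have [SP AP] := S_phi _ mi1.
    have [Sh Ah] := Phih0_pow i.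
    have -> : Ahalf (Phi0 i - Phih0 i) =
        lam (m + i)%N `^ (1 / 2) *: phi (m + i)%N - Ahalf (Phih0 i).
      rewrite addrC -scaleN1r /Ahalf (op_pow_lin (-1) Sh SP).2 scaleN1r addrC.
      by rewrite -AP.
    rewrite (normH_sqrB ip_norm) ip_cross // Ah.
    rewrite (Uvec _ (fun j => lamh (m + j)%N)); last first.
      by move=> j k; rewrite ip_Aphih ?le_N // mi_eq.
    rewrite (normH_sqrB ip_norm) Phih0_norm !(normH_sqr ip_norm) ipZl ipZr.
    rewrite /Phi0 /slice phi_on // eqxx mulr1n mulr1 -expr2 sqr_powR_half ?lam_gt0 //.
    ring.
  under eq_bigr do rewrite lhsE.
  rewrite big_split; congr (_ + _); rewrite !sumrB; congr (_ - _).
  (* Summing over [i] first gives each [lamh (m + j)] the total weight of column [j], which is 1. *)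
  rewrite exchange_big; apply: eq_bigr => j _.
  by rewrite -mulr_suml Ucol mul1r.
Qed.
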